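(* Let $N\ge1$ and suppose that the risk measure is polytopic. For every $x_0\in\mathbb R^{n_x}$ and $i_0\in\mathcal N$, the value $V_N^\star(x_0,i_0)$ equals the optimal value of the following minimization problem over the scenario tree with root state $x_0$ and initial mode $i_0$ (with optimal value $+\infty$ if infeasible): $$\begin{aligned} \text{minimize}\quad&\ell(x_0,u^1,i_0)+b(P_{i^1})^\top y^1+\lambda^1\\ \text{subject to}\quad&\ell_N(x^\iota,i^\eta)\le\tau^\iota_\eta,&&\eta\in\operatorname{child}(\iota),\ \iota\in\Omega_N,\\ &\ell(x^\iota,u^\eta,i^\eta)+b(P_{i^\eta})^\top y^\eta+\lambda^\eta\le\tau^\iota_\eta,&&\eta\in\operatorname{child}(\iota),\ \iota\in\Omega_k,\ k=1,\dots,N-1,\\ &\tau^\iota_\eta=\big(F(P_{i^\iota})^\top y^\iota\big)_{i^\eta}+\lambda^\iota,&&\eta\in\operatorname{child}(\iota),\ \iota\in\Omega_k,\ k=1,\dots,N,\\ &x^\eta=f(x^\iota,u^\eta,i^\eta),&&\eta\in\operatorname{child}(\iota),\ \iota\in\Omega_k,\ k=0,\dots,N-1,\\ &y^\iota\ge0,&&\iota\in\Omega_k,\ k=1,\dots,N, \end{aligned}$$ where the decision variables are $x^\eta\in\mathbb R^{n_x}$ and $u^\eta\in\mathbb R^{n_u}$ for $\eta\in\Omega_1\cup\dots\cup\Omega_N$, and $y^\iota\in\mathbb R^q$, $\lambda^\iota\in\mathbb R$, $\tau^\iota=(\tau^\iota_\eta)_{\eta\in\operatorname{child}(\iota)}$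 real for $\iota\in\Omega_1\cup\dots\cup\Omega_N$, and $x^0=x_0$.
   Context: Let $\mathcal N=\{1,\dots,n\}$ and let $P=(p_{ij})$ be the transition matrix of a Markov chain on $\mathcal N$; $P_i$ is the $i$-th row of $P$ and $\operatorname{cov}(i)=\{j\in\mathcal N:p_{ij}>0\}$. For a nonempty set $E$, $\operatorname{fcns}(E,\mathcal N)$ is the set of functions $V:E\times\mathcal N\to\mathbb R\cup\{+\infty\}$ with $V(x,i)\ge0$ and $V(0,i)=0$ for all $x\in E$, $i\in\mathcal N$. For each $i\in\mathcal N$, $f(\cdot,\cdot,i):\mathbb R^{n_x}\times\mathbb R^{n_u}\to\mathbb R^{n_x}$ is continuous with $f(0,0,i)=0$. The stage and terminal costs are $\ell\in\operatorname{fcns}(\mathbb R^{n_x}\times\mathbb R^{n_u},\mathcal N)$ and $\ell_N\in\operatorname{fcns}(\mathbb R^{n_x},\mathcal N)$ (possibly extended-real-valued, thereby encoding constraints; a constraint with left-hand side $+\infty$ is violated). Risk. The coherent risk measure has ambiguity sets $\mathcal A(p)$: for every probability vector $p\in\mathbb R^n$, $\mathcal A(p)\subseteq\mathbb R^n$ is a compact convex set of probability vectors containing $p$. It is polytopic, meaning $\mathcal A(p)=\{\mu\in\mathbb R^n:\sum_{j=1}^n\mu_j=1,\ F(p)\mu\le b(p)\}$ for some $F(p)\in\mathbb R^{q\times n}$, $b(p)\in\mathbb R^q$. The Markov risk measure is $\rho_i[Z;j]=\max_{\mu\in\mathcal A(P_i)}\sum_{j\in\mathcal N}\mu_jZ(i,j)$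 (for $[0,+\infty]$-valued $Z$: supremum, with $0\cdot\infty=0$). Dynamic programming. $V_0^\star=\ell_N$ and, for $k=0,\dots,N-1$, $$V_{k+1}^\star(x,i)=\inf_{u\in\mathbb R^{n_u}}\Big\{\ell(x,u,i)+\rho_i\big[V_k^\star(f(x,u,i),j);j\big]\Big\}.$$ Scenario tree. The tree has node stages $\Omega_0=\{0\}$ (root), $\Omega_1=\{1\}$, $\Omega_2,\dots,\Omega_{N+1}$. Each node $\eta$ other than the root carries a mode $i^\eta\in\mathcal N$ (the mode leading to that node). The root has the single child $1$, with $i^1=i_0$. For $k=1,\dots,N$, every $\iota\in\Omega_k$ has a set of children $\operatorname{child}(\iota)\subseteq\Omega_{k+1}$ (the nodes reachable from $\iota$), containing exactly one child $\eta$ with $i^\eta=j$ for each $j\in\operatorname{cov}(i^\iota)$; the sets $\operatorname{child}(\iota)$, $\iota\in\Omega_k$, partition $\Omega_{k+1}$. The variables $x^\eta$ and $u^\eta$ are the state at node $\eta$ and the input leading to node $\eta$. For a vector $v\in\mathbb R^n$, $(v)_j$ is its $j$-th coordinate.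
   Formalization: The formal theorem additionally assumes that every μ in A(P_i) vanishes outside cov(i); without this the claim fails, e.g. for N=1, P the identity and A(p) the whole simplex. *)

(* Defs.v *)
From mathcomp Require Import all_boot all_order all_algebra.
From mathcomp Require Import all_classical all_reals all_analysis.

Set Implicit Arguments.
Unset Strict Implicit.
Unset Printing Implicit Defensive.

Import Order.TTheory GRing.Theory Num.Theory.
Import numFieldNormedType.Exports.

Local Open Scope classical_set_scope.
Local Open Scope ring_scope.

(* The mode set {1, ..., n} is 'I_n and R^m is 'cV[R]_m. *)

(* V : E x {modes} -> R u {+oo} with V >= 0 and V(0, .) = 0; nonnegativity
   excludes the value -oo of \bar R. *)
Definition fcns (R : realType) (n : nat) (E : nmodType)
    (V : E -> 'I_n -> \bar R) : Prop :=
  (forall x i, (0%E <= V x i)%E) /\ (forall i, V 0 i = 0%E).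

Definition prob_vector (R : realType) (n : nat) (p : 'cV[R]_n) : Prop :=
  (forall j, 0 <= p j 0) /\ \sum_j p j 0 = 1.

Definition prow (R : realType) (n : nat) (P : 'M[R]_n) (i : 'I_n) : 'cV[R]_n :=
  (row i P)^T.

Definition transition_matrix (R : realType) (n : nat) (P : 'M[R]_n) : Prop :=
  forall i, prob_vector (prow P i).

Definition cov (R : realType) (n : nat) (P : 'M[R]_n) (i : 'I_n) : {set 'I_n} :=
  [set j | 0 < P i j]%SET.

Definition ambiguity_family (R : realType) (n : nat)
    (A : 'cV[R]_n -> set 'cV[R]_n) : Prop :=
  forall p, prob_vector p ->
    [/\ compact (A p), convex_set (A p), A p `<=` [set mu | prob_vector mu]
      & A p p].

Definition polytopic (R : realType) (n q : nat) (A : 'cV[R]_n -> set 'cV[R]_n)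
    (F : 'cV[R]_n -> 'M[R]_(q, n)) (b : 'cV[R]_n -> 'cV[R]_q) : Prop :=
  forall p, prob_vector p ->
    A p = [set mu : 'cV[R]_n | \sum_j mu j 0 = 1 /\
                    forall r, (F p *m mu) r 0 <= b p r 0].

Definition abs_continuous (R : realType) (n : nat) (mu p : 'cV[R]_n) : Prop :=
  forall j, p j 0 = 0 -> mu j 0 = 0.

(* A coherent risk measure on the probability space ({1, ..., n}, p) acts on
   random variables modulo p-null sets, so the measures in its dual
   representation are absolutely continuous with respect to p.  Only p = P_i is
   ever used.  The scenario tree branches over cov(i) alone, so it cannot see
   mass that an ambiguity set would put on modes outside cov(i). *)
Definition ambiguity_dominated (R : realType) (n : nat) (P : 'M[R]_n)
    (A : 'cV[R]_n -> set 'cV[R]_n) : Prop :=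
  forall i mu, A (prow P i) mu -> abs_continuous mu (prow P i).

(* rho_i[Z; j]; the product of \bar R satisfies 0 * +oo = 0. *)
Definition markov_risk (R : realType) (n : nat) (P : 'M[R]_n)
    (A : 'cV[R]_n -> set 'cV[R]_n) (i : 'I_n) (Z : 'I_n -> 'I_n -> \bar R) :
    \bar R :=
  ereal_sup [set (\sum_j (mu j 0)%:E * Z i j)%E | mu in A (prow P i)].

Fixpoint value (R : realType) (n nx nu : nat) (P : 'M[R]_n)
    (A : 'cV[R]_n -> set 'cV[R]_n)
    (f : 'cV[R]_nx * 'cV[R]_nu -> 'I_n -> 'cV[R]_nx)
    (l : 'cV[R]_nx * 'cV[R]_nu -> 'I_n -> \bar R)
    (lN : 'cV[R]_nx -> 'I_n -> \bar R) (k : nat) (x : 'cV[R]_nx) (i : 'I_n) :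
    \bar R :=
  match k with
  | 0%N => lN x i
  | k'.+1 =>
      ereal_inf (range (fun u : 'cV[R]_nu =>
        l (x, u) i +
        markov_risk P A i (fun i' j => value P A f l lN k' (f (x, u) i') j))%E)
  end.

(* Omega_k is the set of nodes of stage k.  The mode of the root and the
   children of the nodes of stage N + 1 are irrelevant and left arbitrary. *)
Record scenario_tree (R : realType) (n N : nat) (P : 'M[R]_n) (i0 : 'I_n) :=
  ScenarioTree {
    node :> finType;
    stage : node -> nat;
    mode : node -> 'I_n;
    child : node -> {set node};
    root : node;
    first : node;
    stage_le : forall v, (stage v <= N.+1)%N;
    stage0 : forall v, stage v = 0%N <-> v = root;
    stage1 : forall v, stage v = 1%N <-> v = first;
    child_root : child root = [set first]%SET;
    mode_first : mode first = i0;
    child_stage : forall v w, (1 <= stage v <= N)%N -> w \in child v ->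
      stage w = (stage v).+1;
    child_cov : forall v w, (1 <= stage v <= N)%N -> w \in child v ->
      mode w \in cov P (mode v);
    child_mode : forall v j, (1 <= stage v <= N)%N -> j \in cov P (mode v) ->
      exists! w, w \in child v /\ mode w = j;
    (* with child_stage: the sets child(v), v in Omega_k, partition
       Omega_(k+1) *)
    child_partition : forall k w, (1 <= k <= N)%N -> stage w = k.+1 ->
      exists! v, stage v = k /\ w \in child v
  }.

(* The components are indexed by all nodes; those at nodes where the problem
   has no variable occur neither in the constraints nor in the objective. *)
Record decision (R : realType) (n N nx nu q : nat) (P : 'M[R]_n) (i0 : 'I_n)
    (T : scenario_tree N P i0) := Decision {
  dx : T -> 'cV[R]_nx;
  du : T -> 'cV[R]_nu;
  dy : T -> 'cV[R]_q;
  dlambda : T -> R;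
  dtau : T -> T -> R (* dtau v w is tau^v_w *)
}.

(* b(P_{i^v})^T y^v + lambda^v *)
Definition dual_cost (R : realType) (n N nx nu q : nat) (P : 'M[R]_n)
    (i0 : 'I_n) (T : scenario_tree N P i0) (b : 'cV[R]_n -> 'cV[R]_q)
    (d : decision nx nu q T) (v : T) : R :=
  ((b (prow P (mode v)))^T *m dy d v) 0 0 + dlambda d v.

Record feasible (R : realType) (n N nx nu q : nat) (P : 'M[R]_n) (i0 : 'I_n)
    (T : scenario_tree N P i0)
    (F : 'cV[R]_n -> 'M[R]_(q, n)) (b : 'cV[R]_n -> 'cV[R]_q)
    (f : 'cV[R]_nx * 'cV[R]_nu -> 'I_n -> 'cV[R]_nx)
    (l : 'cV[R]_nx * 'cV[R]_nu -> 'I_n -> \bar R)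
    (lN : 'cV[R]_nx -> 'I_n -> \bar R) (x0 : 'cV[R]_nx)
    (d : decision nx nu q T) : Prop := Feasible {
  feas_root : dx d (root T) = x0;
  feas_terminal : forall v w, stage v = N -> w \in child v ->
    (lN (dx d v) (mode w) <= (dtau d v w)%:E)%E;
  feas_stage : forall v w, (1 <= stage v <= N.-1)%N -> w \in child v ->
    (l (dx d v, du d w) (mode w) + (dual_cost b d w)%:E <= (dtau d v w)%:E)%E;
  feas_tau : forall v w, (1 <= stage v <= N)%N -> w \in child v ->
    dtau d v w =
      ((F (prow P (mode v)))^T *m dy d v) (mode w) 0 + dlambda d v;
  feas_dynamics : forall v w, (stage v <= N.-1)%N -> w \in child v ->
    dx d w = f (dx d v, du d w) (mode w);
  feas_dual : forall v, (1 <= stage v <= N)%N -> forall r, 0 <= dy d v r 0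
}.

Definition objective (R : realType) (n N nx nu q : nat) (P : 'M[R]_n)
    (i0 : 'I_n) (T : scenario_tree N P i0) (b : 'cV[R]_n -> 'cV[R]_q)
    (l : 'cV[R]_nx * 'cV[R]_nu -> 'I_n -> \bar R) (x0 : 'cV[R]_nx)
    (d : decision nx nu q T) : \bar R :=
  (l (x0, du d (first T)) i0 + (dual_cost b d (first T))%:E)%E.

(* The infimum over the empty set is +oo. *)
Definition optimal_value (R : realType) (n N nx nu q : nat) (P : 'M[R]_n)
    (i0 : 'I_n) (T : scenario_tree N P i0)
    (F : 'cV[R]_n -> 'M[R]_(q, n)) (b : 'cV[R]_n -> 'cV[R]_q)
    (f : 'cV[R]_nx * 'cV[R]_nu -> 'I_n -> 'cV[R]_nx)
    (l : 'cV[R]_nx * 'cV[R]_nu -> 'I_n -> \bar R)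
    (lN : 'cV[R]_nx -> 'I_n -> \bar R) (x0 : 'cV[R]_nx) : \bar R :=
  ereal_inf [set objective b l x0 d |
              d in [set d : decision nx nu q T | feasible F b f l lN x0 d]].

(* Main.v *)
(**
  By linear programming duality rho_i[Z] is the least value of b^T y + lambda
  over y >= 0 and lambda with Z_j <= (F^T y)_j + lambda on cov(i); the other modes
  impose nothing because the ambiguity set charges only cov(i).  Weak duality,
  applied from the leaves to the root, bounds the value function by the objective
  of any feasible point.  Conversely, a real t0 above the value at the root is
  treated as a budget: each node picks an input and multipliers whose cost stays
  within its budget, and tau hands each child a budget strictly above the
  cost-to-go there, which yields a feasible point of objective at most t0.
*)

Require Import Defs.
From mathcomp Require Import all_boot all_order all_algebra.
From mathcomp Require Import all_classical all_reals all_analysis.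
From mathcomp Require Import lra zify.

Import Order.TTheory GRing.Theory Num.Theory.
Import numFieldNormedType.Exports.

Local Open Scope classical_set_scope.
Local Open Scope ring_scope.

(** * Farkas' lemma and linear programming duality *)

Lemma mulmx_ge0 {R : realFieldType} {m : nat} (y : 'rV[R]_m) (v : 'cV[R]_m) :
  (forall i, 0 <= y 0 i) -> (forall i, 0 <= v i 0) -> 0 <= (y *m v) 0 0.
Proof. by move=> y0 v0; rewrite mxE; apply: sumr_ge0 => i _; apply: mulr_ge0. Qed.

Lemma mx11E {R : pzRingType} (M N : 'M[R]_1) : M 0 0 = N 0 0 -> M = N.
Proof. by move=> h; apply/matrixP => i j; rewrite !ord1. Qed.

(* Bartl's proof: the case of one more row [a] reduces to the projections of the
   other rows and of [c] along some [x1] with [a *m x1 = 1]. *)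
Lemma farkas {R : realFieldType} {m k : nat} (A : 'M[R]_(m, k)) (c : 'rV[R]_k) :
  (forall x : 'cV[R]_k, (forall i, (A *m x) i 0 <= 0) -> (c *m x) 0 0 <= 0) ->
  exists2 y : 'rV[R]_m, forall i, 0 <= y 0 i & c = y *m A.
Proof.
elim: m => [|m IH] in A c *.
  move=> h; exists 0; first by case.
  apply/rowP => j; rewrite mul0mx mxE; apply/eqP; rewrite eq_le.
  have P (e : R) : e * c 0 j <= 0.
    by have := h (e *: delta_mx j 0) ltac:(by case); rewrite -scalemxAr -colE !mxE.
  by have := P 1; have := P (-1); rewrite mul1r mulN1r oppr_le0 => -> ->.
rewrite -[m.+1]/(1 + m)%N in A *.
rewrite -[A]vsubmxK; move: (usubmx A) (dsubmx A) => a B h.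
(* If the rows of [B] already imply the inequality for [c], the row [a] gets multiplier zero. *)
have [hB|/existsNP[x0 /not_implyP[hx0 /negP]]] := pselect
  (forall x : 'cV[R]_k, (forall i, (B *m x) i 0 <= 0) -> (c *m x) 0 0 <= 0).
  have [y y0 ->] := IH _ _ hB.
  exists (row_mx 0 y); last by rewrite mul_row_col mul0mx add0r.
  by move=> i; rewrite mxE; case: splitP => j _; rewrite ?mxE.
rewrite -ltNge => cx0.
have ax0 : 0 < (a *m x0) 0 0.
  rewrite ltNge; apply/negP => ax0; suff : (c *m x0) 0 0 <= 0 by rewrite leNgt cx0.
  apply: h => i; rewrite mul_col_mx mxE; case: splitP => j _ //.
  by rewrite ord1.
set x1 := ((a *m x0) 0 0)^-1 *: x0.
have ax1 : a *m x1 = 1%:M.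
  by apply: mx11E; rewrite -scalemxAr mxE mulVf ?gt_eqF // mxE.
have Bx1 i : (B *m x1) i 0 <= 0.
  by rewrite -scalemxAr mxE pmulr_rle0 ?invr_gt0.
have cx1 : 0 <= (c *m x1) 0 0.
  by rewrite -scalemxAr mxE pmulr_rge0 ?invr_gt0 // ltW.
have [x hx|y y0 hy] := IH (B - B *m x1 *m a) (c - c *m x1 *m a).
  have E D (M : 'M[R]_(D, k)) : (M - M *m x1 *m a) *m x = M *m (x - x1 *m (a *m x)).
    by rewrite mulmxBl mulmxBr !mulmxA.
  rewrite E; apply: h => i; rewrite mul_col_mx mxE; case: splitP => j _.
    by rewrite mulmxBr mulmxA ax1 mul1mx subrr mxE.
  by rewrite -E.
(* Expanding the projected identity [hy] leaves this coefficient on [a]; it is nonnegative because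
   [c *m x1 >= 0], [B *m x1 <= 0] and [y >= 0]. *)
exists (row_mx (c *m x1 - y *m (B *m x1)) y).
  move=> i; rewrite mxE; case: splitP => j _ //.
  rewrite ord1 mxE addr_ge0 // -mulmxN mulmx_ge0 // => r.
  by rewrite mxE oppr_ge0.
rewrite mul_row_col -[LHS](subrK (c *m x1 *m a)) hy mulmxBr mulmxBl !mulmxA.
by rewrite addrC addrA addrAC.
Qed.

(** Homogenization: a new coordinate [s >= 0] multiplies [g], which makes the claim a case of
    [farkas]. For [s > 0], dividing by [s] returns to the affine system; for [s = 0], [x] is a
    recession direction, which is added to a point of the nonempty polyhedron. *)
Lemma affine_farkas {R : realFieldType} {m k : nat} (G : 'M[R]_(m, k))
    (g : 'cV[R]_m) (z : 'rV[R]_k) (v : R) :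
  (exists x : 'cV[R]_k, forall i, (G *m x) i 0 <= g i 0) ->
  (forall x : 'cV[R]_k, (forall i, (G *m x) i 0 <= g i 0) -> (z *m x) 0 0 <= v) ->
  exists2 y : 'rV[R]_m, forall i, 0 <= y 0 i & z = y *m G /\ (y *m g) 0 0 <= v.
Proof.
move=> [x0 hx0] h.
have [|y y0] := @farkas R _ _ (block_mx G (- g) 0 (- 1%:M)) (row_mx z (- v%:M)).
  move=> x; rewrite -[x]vsubmxK; move: (usubmx x) (dsubmx x) => {}x s hx.
  have Ex i : (G *m x) i 0 <= s 0 0 * g i 0.
    have := hx (lshift 1 i); rewrite mul_block_col col_mxEu [s]mx11_scalar.
    rewrite mulNmx mul_mx_scalar [fun_of_matrix (_ - _) i 0]mxE.
    rewrite [fun_of_matrix (- _) i 0]mxE [fun_of_matrix (_ *: _) i 0]mxE.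
    by rewrite subr_le0 -mx11_scalar.
  have s0 : 0 <= s 0 0.
    have := hx (rshift m 0); rewrite mul_block_col col_mxEd mul0mx mulNmx mul1mx.
    by rewrite add0r [fun_of_matrix (- _) 0 0]mxE oppr_le0.
  rewrite mul_row_col mulNmx mul_scalar_mx [fun_of_matrix (_ - _) 0 0]mxE.
  rewrite [fun_of_matrix (- _) 0 0]mxE.
  rewrite [fun_of_matrix (_ *: _) 0 0]mxE subr_le0.
  have [s1|] := boolP (0 < s 0 0).
    have := h ((s 0 0)^-1 *: x); rewrite -!scalemxAr [fun_of_matrix (_ *: _) 0 0]mxE.
    rewrite ler_pdivrMl // [v * _]mulrC; apply => i.
    by rewrite [fun_of_matrix (_ *: _) i 0]mxE ler_pdivrMl.
  rewrite -leNgt => s1; have {s0 s1} s0 : s 0 0 = 0 by apply: le_anti; rewrite s1 s0.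
  rewrite s0 mulr0 leNgt; apply/negP => zx.
  (* a recession direction with positive cost would make the maximum infinite *)
  set t := (v - (z *m x0) 0 0 + 1) / (z *m x) 0 0.
  have vx0 : (z *m x0) 0 0 <= v by exact: h.
  have : (z *m (x0 + t *: x)) 0 0 <= v.
    apply: h => i; rewrite mulmxDr -scalemxAr [fun_of_matrix (_ + _) i 0]mxE.
    rewrite -[leRHS]addr0.
    apply: lerD => //; rewrite [fun_of_matrix (_ *: _) i 0]mxE mulr_ge0_le0 //.
      by rewrite divr_ge0 ?(ltW zx) // addr_ge0 // subr_ge0.
    by have := Ex i; rewrite s0 mul0r.
  rewrite mulmxDr -scalemxAr [fun_of_matrix (_ + _) 0 0]mxE.
  rewrite [fun_of_matrix (_ *: _) 0 0]mxE divfK ?gt_eqF //.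
  lra.
rewrite -[y]hsubmxK mul_row_block => /eq_row_mx[zE vE].
exists (lsubmx y); first by move=> i; rewrite mxE.
split; first by rewrite zE mulmx0 addr0.
(* The last column says that [v] is [y *m g] plus the nonnegative multiplier of the row
   [- s <= 0]. *)
have := congr1 (fun M : 'M[R]_1 => M 0 0) vE.
rewrite !mulmxN mulmx1 [fun_of_matrix (_ - _) 0 0]mxE ![fun_of_matrix (- _) 0 0]mxE.
rewrite [fun_of_matrix (v%:M) 0 0]mxE [fun_of_matrix (rsubmx y) 0 0]mxE eqxx mulr1n.
have := y0 (rshift m 0).
lra.
Qed.

(** The equation on the sum of [mu] enters as two opposite inequalities; [lam], free in sign, is the
    difference of their nonnegative multipliers. *)
Lemma simplex_lp_duality {R : realFieldType} {q n : nat} (F : 'M[R]_(q, n))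
    (b : 'cV[R]_q) (z : 'cV[R]_n) (v : R) :
  (exists2 mu : 'cV[R]_n, \sum_j mu j 0 = 1 & forall r, (F *m mu) r 0 <= b r 0) ->
  (forall mu : 'cV[R]_n, \sum_j mu j 0 = 1 ->
    (forall r, (F *m mu) r 0 <= b r 0) -> \sum_j mu j 0 * z j 0 <= v) ->
  exists y : 'cV[R]_q, exists lam : R,
    [/\ forall r, 0 <= y r 0, forall j, z j 0 = (F^T *m y) j 0 + lam
      & (b^T *m y) 0 0 + lam <= v].
Proof.
move=> [mu0 s0 F0] h.
pose one : 'rV[R]_n := const_mx 1.
have oneE (mu : 'cV[R]_n) : (one *m mu) 0 0 = \sum_j mu j 0.
  by rewrite mxE; apply: eq_bigr => j _; rewrite mxE mul1r.
pose G := col_mx F (col_mx one (- one)).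
pose g := col_mx b (col_mx 1%:M (- 1%:M)) : 'cV[R]_(q + (1 + 1)).
have GP (mu : 'cV[R]_n) : (forall i, (G *m mu) i 0 <= g i 0) <->
    \sum_j mu j 0 = 1 /\ forall r, (F *m mu) r 0 <= b r 0.
  rewrite !mul_col_mx; split => [H|[H1 H2] i].
    split; last by move=> r; have := H (lshift _ r); rewrite !col_mxEu.
    have := H (rshift q (lshift 1 0)); have := H (rshift q (rshift 1 0)).
    rewrite !col_mxEd !col_mxEu mulNmx ![fun_of_matrix (- _) 0 0]mxE oneE.
    by rewrite [fun_of_matrix _ 0 0]mxE eqxx lerN2 => H1 H2;
      apply: le_anti; rewrite H1 H2.
  rewrite mxE [leRHS]mxE; case: splitP => j _ //.
  rewrite mxE [leRHS]mxE; case: splitP => r _; rewrite ord1.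
    by rewrite oneE H1 mxE.
  by rewrite mulNmx [fun_of_matrix (- _) 0 0]mxE oneE H1 !mxE.
have [||y y0 [zE yv]] := @affine_farkas R _ _ G g z^T v.
- by exists mu0; apply/GP.
- move=> mu /GP[s1 s2]; rewrite mxE; under eq_bigr do rewrite mxE mulrC.
  exact: h.
rewrite -[y]hsubmxK -[rsubmx y]hsubmxK in y0 zE yv.
move: (lsubmx y) (lsubmx (rsubmx y)) (rsubmx (rsubmx y)) y0 zE yv => {}y a c y0 zE yv.
exists y^T, (a 0 0 - c 0 0); split.
- by move=> r; have := y0 (lshift _ r); rewrite row_mxEl mxE.
- move=> j; rewrite -trmx_mul mxE; have := congr1 (fun M : 'rV[R]_n => M 0 j) zE.
  rewrite !mul_row_col mxE => ->; rewrite mulmxN [a]mx11_scalar [c]mx11_scalar.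
  by rewrite !mul_scalar_mx !mxE eqxx !mulr1n !mulr1.
- rewrite -trmx_mul mxE; move: yv; rewrite !mul_row_col mulmxN !mulmx1.
  by rewrite mxE [X in _ + X]mxE [X in _ + (_ + X)]mxE.
Qed.

(** * Dual description of the Markov risk measure *)

Lemma prow_eq0 {R : realType} {n : nat} (P : 'M[R]_n) (i j : 'I_n) :
  transition_matrix P -> j \notin cov P i -> prow P i j 0 = 0.
Proof.
move=> hP; rewrite inE -leNgt => Pij; have [p0 _] := hP i.
by apply: le_anti; rewrite p0 !mxE Pij.
Qed.

(** Weak duality: averaging the bound on [Z] over [mu] gives [(F mu)^T y + lam], at most
    [b^T y + lam] since [y >= 0]. Outside [cov P i], where [Z] may be infinite, [mu] vanishes by
    domination. *)
Lemma markov_risk_le_dual {R : realType} {n q : nat} (P : 'M[R]_n)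
    (A : 'cV[R]_n -> set 'cV[R]_n) (F : 'cV[R]_n -> 'M[R]_(q, n))
    (b : 'cV[R]_n -> 'cV[R]_q) (i : 'I_n) (Z : 'I_n -> 'I_n -> \bar R)
    (y : 'cV[R]_q) (lam : R) :
  transition_matrix P -> ambiguity_family A -> ambiguity_dominated P A ->
  polytopic A F b -> (forall r, 0 <= y r 0) ->
  (forall j, j \in cov P i ->
    (Z i j <= (((F (prow P i))^T *m y) j 0 + lam)%:E)%E) ->
  (markov_risk P A i Z <= (((b (prow P i))^T *m y) 0 0 + lam)%:E)%E.
Proof.
move=> hP hA hdom hpoly y0 hZ; apply: ge_ereal_sup => _ [mu Amu <-].
have [_ _ /(_ _ Amu)[mu0 mu1] _] := hA _ (hP i).
have Fmu r : (F (prow P i) *m mu) r 0 <= b (prow P i) r 0.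
  by move: Amu; rewrite (hpoly _ (hP i)) => -[_].
apply: (@le_trans _ _
  (\sum_j (mu j 0 * (((F (prow P i))^T *m y) j 0 + lam))%:E)%E).
  apply: lee_sum => j _; have [cj|cj] := boolP (j \in cov P i).
    by rewrite EFinM; apply: lee_wpmul2l; [rewrite lee_fin | exact: hZ].
  by rewrite (hdom _ _ Amu j (prow_eq0 _ _ _ hP cj)) mul0e mul0r.
rewrite sumEFin lee_fin; under eq_bigr do rewrite mulrDr.
rewrite big_split /= -mulr_suml mu1 mul1r lerD2r.
have -> : \sum_j mu j 0 * ((F (prow P i))^T *m y) j 0
    = ((F (prow P i) *m mu)^T *m y) 0 0.
  by rewrite trmx_mul -mulmxA mxE; apply: eq_bigr => j _; rewrite [mu^T _ _]mxE.
rewrite [leLHS]mxE [leRHS]mxE; apply: ler_sum => r _.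
by rewrite ler_wpM2r // mxE [leRHS]mxE.
Qed.

Lemma markov_risk_ge0 {R : realType} {n : nat} (P : 'M[R]_n)
    (A : 'cV[R]_n -> set 'cV[R]_n) (i : 'I_n) (Z : 'I_n -> 'I_n -> \bar R) :
  transition_matrix P -> ambiguity_family A -> (forall j, (0 <= Z i j)%E) ->
  (0 <= markov_risk P A i Z)%E.
Proof.
move=> hP hA Z0; have [_ _ _ Ap] := hA _ (hP i); have [p0 _] := hP i.
apply: le_trans (ereal_sup_ubound _); last by exists (prow P i).
by apply: sume_ge0 => j _; rewrite mule_ge0 // lee_fin.
Qed.

(** The row [P_i] itself lies in its ambiguity set and charges every mode of [cov P i], so an
    infinite [Z] there would make the risk infinite. *)
Lemma markov_risk_fin_cov {R : realType} {n : nat} (P : 'M[R]_n)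
    (A : 'cV[R]_n -> set 'cV[R]_n) (i j : 'I_n) (Z : 'I_n -> 'I_n -> \bar R) :
  transition_matrix P -> ambiguity_family A -> (forall j, (0 <= Z i j)%E) ->
  (markov_risk P A i Z < +oo)%E -> j \in cov P i -> Z i j \is a fin_num.
Proof.
move=> hP hA Z0 rho cj; rewrite ge0_fin_numE // ltey; apply/eqP => Zj.
have [_ _ _ Ap] := hA _ (hP i); have [p0 _] := hP i.
suff : (+oo <= markov_risk P A i Z)%E by rewrite leNgt rho.
apply: le_trans (ereal_sup_ubound _); last by exists (prow P i).
rewrite (bigD1 j) //= Zj gt0_muley; last first.
  by move: cj; rewrite inE lte_fin !mxE.
by apply: leeDl; apply: sume_ge0 => r _; rewrite mule_ge0 // lee_fin.
Qed.

(** Strong duality for the finite vector [fine (Z i j)]. Replacing [+oo] by 0 only lowers the cost,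
    so the risk still bounds it, and [Z] is unchanged on [cov P i], where it is finite. *)
Lemma markov_risk_dual_attained {R : realType} {n q : nat} (P : 'M[R]_n)
    (A : 'cV[R]_n -> set 'cV[R]_n) (F : 'cV[R]_n -> 'M[R]_(q, n))
    (b : 'cV[R]_n -> 'cV[R]_q) (i : 'I_n) (Z : 'I_n -> 'I_n -> \bar R) (r : R) :
  transition_matrix P -> ambiguity_family A -> polytopic A F b ->
  (forall j, (0 <= Z i j)%E) -> (markov_risk P A i Z < r%:E)%E ->
  exists y : 'cV[R]_q, exists lam : R,
    [/\ forall s, 0 <= y s 0,
        forall j, j \in cov P i ->
          (Z i j < (((F (prow P i))^T *m y) j 0 + lam)%:E)%E
      & ((b (prow P i))^T *m y) 0 0 + lam <= r].
Proof.
move=> hP hA hpoly Z0 rho_r.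
have rho0 := @markov_risk_ge0 _ _ _ _ _ _ hP hA Z0.
have rho_oo : (markov_risk P A i Z < +oo)%E by apply: lt_trans rho_r (ltry _).
have rhoE : markov_risk P A i Z = (fine (markov_risk P A i Z))%:E.
  by rewrite fineK // ge0_fin_numE.
have polyE mu : A (prow P i) mu <-> \sum_j mu j 0 = 1 /\
    forall s, (F (prow P i) *m mu) s 0 <= b (prow P i) s 0.
  by rewrite (hpoly _ (hP i)).
have [||y [lam [y0 zE by_le]]] := @simplex_lp_duality _ _ _ (F (prow P i))
  (b (prow P i)) (\col_j fine (Z i j)) (fine (markov_risk P A i Z)).
- have [_ _ _ /polyE[p1 p2]] := hA _ (hP i).
  by exists (prow P i).
- move=> mu mu1 muF; have Amu : A (prow P i) mu by apply/polyE.
  have [_ _ /(_ _ Amu)[mu0 _] _] := hA _ (hP i).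
  rewrite -lee_fin -rhoE; apply: le_trans (ereal_sup_ubound _); last by exists mu.
  rewrite -sumEFin; apply: lee_sum => j _; rewrite mxE EFinM.
  apply: lee_wpmul2l; first by rewrite lee_fin.
  by have := Z0 j; case: (Z i j) => //= _; rewrite leey.
(* The positive gap between [r] and the risk is added to [lam]; this makes the bounds on [Z]
   strict. *)
exists y, (lam + (r - fine (markov_risk P A i Z))); split => //.
- move=> j cj; have Zfin := @markov_risk_fin_cov _ _ _ _ _ _ _ hP hA Z0 rho_oo cj.
  rewrite -(fineK Zfin) lte_fin addrA -zE mxE ltrDl subr_gt0 -lte_fin.
  by rewrite -rhoE.
- by rewrite addrA; lra.
Qed.

(** * The value function: sign and one-step selection *)

Lemma value_ge0 {R : realType} {n nx nu : nat} (P : 'M[R]_n)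
    (A : 'cV[R]_n -> set 'cV[R]_n)
    (f : 'cV[R]_nx * 'cV[R]_nu -> 'I_n -> 'cV[R]_nx)
    (l : 'cV[R]_nx * 'cV[R]_nu -> 'I_n -> \bar R)
    (lN : 'cV[R]_nx -> 'I_n -> \bar R) (k : nat) (x : 'cV[R]_nx) (i : 'I_n) :
  transition_matrix P -> ambiguity_family A -> fcns l -> fcns lN ->
  (0 <= value P A f l lN k x i)%E.
Proof.
move=> hP hA [l0 _] [lN0 _]; elim: k => [|k IH] in x i *; first exact: lN0.
apply: le_ereal_inf_tmp => _ [u _ <-]; apply: adde_ge0; first exact: l0.
by apply: markov_risk_ge0.
Qed.

(* The budget [t] is met with strict slack at the successors, so that the
   construction can be iterated although the infimum over [u] need not be
   attained. *)
Lemma value_step {R : realType} {n nx nu q : nat} (P : 'M[R]_n)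
    (A : 'cV[R]_n -> set 'cV[R]_n) (F : 'cV[R]_n -> 'M[R]_(q, n))
    (b : 'cV[R]_n -> 'cV[R]_q)
    (f : 'cV[R]_nx * 'cV[R]_nu -> 'I_n -> 'cV[R]_nx)
    (l : 'cV[R]_nx * 'cV[R]_nu -> 'I_n -> \bar R)
    (lN : 'cV[R]_nx -> 'I_n -> \bar R) (k : nat) (x : 'cV[R]_nx) (i : 'I_n)
    (t : R) :
  transition_matrix P -> ambiguity_family A -> polytopic A F b ->
  fcns l -> fcns lN -> (value P A f l lN k.+1 x i < t%:E)%E ->
  exists p : 'cV[R]_nu * 'cV[R]_q * R,
    [/\ forall s, 0 <= p.1.2 s 0,
        (l (x, p.1.1) i + (((b (prow P i))^T *m p.1.2) 0 0 + p.2)%:E <= t%:E)%E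
      & forall j, j \in cov P i ->
          (value P A f l lN k (f (x, p.1.1) i) j
            < (((F (prow P i))^T *m p.1.2) j 0 + p.2)%:E)%E].
Proof.
move=> hP hA hpoly hl hlN /ereal_inf_lt[_ [u _ <-]].
set Z := fun i' j => value P A f l lN k (f (x, u) i') j => lt_t.
have Z0 j : (0 <= Z i j)%E by exact: value_ge0.
have rho0 := @markov_risk_ge0 _ _ _ _ _ _ hP hA Z0.
(* The risk is nonnegative and the sum is below [t], so the stage cost is finite and can be
   subtracted from the budget. *)
have l_fin : l (x, u) i \is a fin_num.
  rewrite ge0_fin_numE; last exact: hl.1.
  by apply: le_lt_trans (lt_trans lt_t (ltry _)); apply: leeDl.
have : (markov_risk P A i Z < (t - fine (l (x, u) i))%:E)%E.
  by rewrite EFinB fineK // lteBrDl.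
move=> /(@markov_risk_dual_attained _ _ _ _ _ _ _ _ _ _ hP hA hpoly Z0).
move=> [y [lam [y0 hZ hb]]]; exists (u, y, lam); split => //=.
by rewrite -(fineK l_fin) -EFinD lee_fin -lerBrDl.
Qed.

(** * Comparison of the value function with the tree problem *)

(** Backward induction, [k] being the number of stages from [v] to stage [N]. At a child [w], the
    input [du d w] bounds the infimum in the value function, and the dynamics at [w] make the
    induction hypothesis apply to the remaining risk. *)
Lemma markov_risk_le_dual_cost {R : realType} {n nx nu q N : nat} (P : 'M[R]_n)
    (A : 'cV[R]_n -> set 'cV[R]_n) (F : 'cV[R]_n -> 'M[R]_(q, n))
    (b : 'cV[R]_n -> 'cV[R]_q)
    (f : 'cV[R]_nx * 'cV[R]_nu -> 'I_n -> 'cV[R]_nx)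
    (l : 'cV[R]_nx * 'cV[R]_nu -> 'I_n -> \bar R)
    (lN : 'cV[R]_nx -> 'I_n -> \bar R) (x0 : 'cV[R]_nx) (i0 : 'I_n)
    (T : scenario_tree N P i0) (d : decision nx nu q T) (k : nat) (v : T) :
  transition_matrix P -> ambiguity_family A -> ambiguity_dominated P A ->
  polytopic A F b -> feasible F b f l lN x0 d ->
  (1 <= stage v)%N -> (stage v + k)%N = N ->
  (markov_risk P A (mode v) (fun _ j => value P A f l lN k (dx d v) j)
    <= (dual_cost b d v)%:E)%E.
Proof.
move=> hP hA hdom hpoly fd; elim: k => [|k IH] in v * => v1 vN.
  have sv : (1 <= stage v <= N)%N by lia.
  apply: markov_risk_le_dual hpoly _ _ => //; first exact: feas_dual fd _ sv.
  move=> j /(child_mode sv)[w [[vw <-] _]].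
  rewrite -(feas_tau fd sv vw); apply: (feas_terminal fd) vw.
  by lia.
have sv : (1 <= stage v <= N)%N by lia.
have sv' : (1 <= stage v <= N.-1)%N by lia.
apply: markov_risk_le_dual hpoly _ _ => //; first exact: feas_dual fd _ sv.
move=> j /(child_mode sv)[w [[vw <-] _]].
rewrite -(feas_tau fd sv vw); apply: le_trans (feas_stage fd sv' vw).
apply: le_trans (ereal_inf_lbound _) _; first by exists (du d w).
apply: leeD2l; have := IH w; rewrite (feas_dynamics fd _ vw); last by case/andP: sv'.
by apply; rewrite (child_stage sv vw); lia.
Qed.

(** A policy chosen from [value_step] is run down the tree from state [x0] and budget [t0]; the
    budgets passed to the children are the variables [tau]. *)
Lemma exists_feasible_budget {R : realType} {n nx nu q N : nat} (P : 'M[R]_n)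
    (A : 'cV[R]_n -> set 'cV[R]_n) (F : 'cV[R]_n -> 'M[R]_(q, n))
    (b : 'cV[R]_n -> 'cV[R]_q)
    (f : 'cV[R]_nx * 'cV[R]_nu -> 'I_n -> 'cV[R]_nx)
    (l : 'cV[R]_nx * 'cV[R]_nu -> 'I_n -> \bar R)
    (lN : 'cV[R]_nx -> 'I_n -> \bar R) (x0 : 'cV[R]_nx) (i0 : 'I_n)
    (T : scenario_tree N P i0) (t0 : R) :
  transition_matrix P -> ambiguity_family A -> polytopic A F b ->
  fcns l -> fcns lN -> (1 <= N)%N -> (value P A f l lN N x0 i0 < t0%:E)%E ->
  exists2 d : decision nx nu q T,
    feasible F b f l lN x0 d & (objective b l x0 d <= t0%:E)%E.
Proof.
move=> hP hA hpoly hl hlN hN hV.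
have /choice[pol polP] (a : nat * 'cV[R]_nx * 'I_n * R) :
  exists p : 'cV[R]_nu * 'cV[R]_q * R,
    (value P A f l lN a.1.1.1.+1 a.1.1.2 a.1.2 < a.2%:E)%E ->
    [/\ forall s, 0 <= p.1.2 s 0,
        (l (a.1.1.2, p.1.1) a.1.2
          + (((b (prow P a.1.2))^T *m p.1.2) 0 0 + p.2)%:E <= a.2%:E)%E
      & forall j, j \in cov P a.1.2 ->
          (value P A f l lN a.1.1.1 (f (a.1.1.2, p.1.1) a.1.2) j
            < (((F (prow P a.1.2))^T *m p.1.2) j 0 + p.2)%:E)%E].
  have [ha|ha] := pselect (value P A f l lN a.1.1.1.+1 a.1.1.2 a.1.2 < a.2%:E)%E.
    by have [p hp] := @value_step _ _ _ _ _ _ _ _ _ _ _ _ _ _ _ _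
      hP hA hpoly hl hlN ha; exists p.
  (* The implication is vacuous here, so any triple serves. *)
  by exists (0, 0, 0).
(* The stage test matters: nodes of stage [N.+1] have arbitrary [child] sets, which could contain
   [w]. *)
pose parent (w : T) : T :=
  odflt w [pick v | (stage v == (stage w).-1) && (w \in child v)].
have parentE v w : (1 <= stage v <= N)%N -> w \in child v -> parent w = v.
  move=> sv vw; have sw := child_stage sv vw; rewrite /parent.
  have [v' [_ uniq_v]] := child_partition sv sw.
  case: pickP => [v1 /andP[/eqP sv1 v1w]|/(_ v)]; last by rewrite sw eqxx vw.
  by rewrite -(uniq_v v) // -(uniq_v v1) // sv1 sw.
(* [st m w], for [w] of stage m.+1, is the state at the parent of [w] paired
   with the budget for the cost-to-go at [w]. *)
pose st := fix st (m : nat) (w : T) : 'cV[R]_nx * R :=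
  if m is m'.+1 then
    let v := parent w in let e := st m' v in
    let p := pol ((N - m)%N, e.1, mode v, e.2) in
    (f (e.1, p.1.1) (mode v), ((F (prow P (mode v)))^T *m p.1.2) (mode w) 0 + p.2)
  else (x0, t0).
pose e (w : T) := st (stage w).-1 w.
(* The input leading to [w] is still to be chosen, so the cost-to-go at [w] is the value with
   [(N - stage w).+1] steps; [pol] takes the predecessor of that number. *)
pose arg (w : T) := ((N - stage w)%N, (e w).1, mode w, (e w).2).
pose p (w : T) := pol (arg w).
pose tau (v w : T) := ((F (prow P (mode v)))^T *m (p v).1.2) (mode w) 0 + (p v).2.
have eE v w : (1 <= stage v <= N)%N -> w \in child v ->
    e w = (f ((e v).1, (p v).1.1) (mode v), tau v w).
  move=> sv vw; have sw := child_stage sv vw.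
  have v1 : (stage v).-1.+1 = stage v by rewrite prednK //; case/andP: sv.
  by rewrite /e sw -[in LHS]v1 /= (parentE _ _ sv vw) v1.
have stage_first : stage (first T) = 1%N by apply/stage1.
have e_first : e (first T) = (x0, t0) by rewrite /e stage_first.
have root_stage (v : T) : (1 <= stage v)%N -> (v == Defs.root T) = false.
  by move=> v1; apply/eqP => /stage0 v0; rewrite v0 in v1.
(* On stages 1 to [N] the budget strictly exceeds the cost-to-go: by hypothesis at the first node,
   then by the last clause of [polP] at the parent. *)
have invariant m w : stage w = m.+1 -> (m < N)%N ->
    (value P A f l lN (N - stage w).+1 (e w).1 (mode w) < (e w).2%:E)%E.
  elim: m w => [|m IH] w sw mN.
    move: (sw) => /stage1 ->; rewrite e_first mode_first stage_first.
    by rewrite -subSn // subn1.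
  have mN' : (1 <= m.+1 <= N)%N by lia.
  have [v [[sv vw] _]] := child_partition mN' sw.
  rewrite -sv in mN'; rewrite (eE _ _ mN' vw) sw -subSn // subSS -sv.
  have [_ _] := polP (arg v) (IH v sv (ltnW mN)).
  by apply; exact: child_cov vw.
have pP v (sv : (1 <= stage v <= N)%N) :=
  polP (arg v) (invariant (stage v).-1 v ltac:(by lia) ltac:(by lia)).
exists (Decision (fun w => if w == Defs.root T then x0
                           else f ((e w).1, (p w).1.1) (mode w))
         (fun w => (p w).1.1) (fun w => (p w).1.2) (fun w => (p w).2) tau).
  split => /=.
  - by rewrite eqxx.
  - move=> v w sv vw; have sv' : (1 <= stage v <= N)%N by lia.
    rewrite root_stage; last by case/andP: sv'.
    (* At stage [N] no step is left, so the value at the children is [lN] itself. *)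
    have [_ _] := pP v sv'; rewrite /= {1}sv subnn => h.
    by apply/ltW/h; exact: child_cov vw.
  - move=> v w sv vw.
    have sv' : (1 <= stage v <= N)%N by lia.
    have sw := child_stage sv' vw.
    have sw' : (1 <= stage w <= N)%N.
      by rewrite sw; lia.
    rewrite root_stage; last by case/andP: sv.
    by have [_ + _] := pP w sw'; rewrite /= -/(p w) (eE _ _ sv' vw).
  - by [].
  - move=> v w sv vw; have [v0|v0] := eqVneq v (Defs.root T).
      move: vw; rewrite v0 child_root inE => /eqP ->.
      by rewrite root_stage ?stage_first // e_first.
    have v1 : stage v != 0%N by apply: contra_neq v0 => /stage0.
    have sv' : (1 <= stage v <= N)%N by lia.
    by rewrite root_stage ?(child_stage sv' vw) // (eE _ _ sv' vw).
  - by move=> v sv; have [] := pP v sv.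
have [|_ + _] := pP (first T); first by rewrite stage_first.
by rewrite /objective /dual_cost /= -/(p _) e_first mode_first.
Qed.

Theorem mainTheorem4 (R : realType) (n nx nu q N : nat)
    (P : 'M[R]_n) (A : 'cV[R]_n -> set 'cV[R]_n)
    (F : 'cV[R]_n -> 'M[R]_(q, n)) (b : 'cV[R]_n -> 'cV[R]_q)
    (f : 'cV[R]_nx * 'cV[R]_nu -> 'I_n -> 'cV[R]_nx)
    (l : 'cV[R]_nx * 'cV[R]_nu -> 'I_n -> \bar R)
    (lN : 'cV[R]_nx -> 'I_n -> \bar R)
    (hP : transition_matrix P)
    (hf : forall i, continuous (fun z => f z i))
    (hf0 : forall i, f (0, 0) i = 0)
    (hl : fcns l) (hlN : fcns lN)
    (hA : ambiguity_family A)
    (hdom : ambiguity_dominated P A)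
    (hpoly : polytopic A F b)
    (hN : (1 <= N)%N)
    (x0 : 'cV[R]_nx) (i0 : 'I_n) (T : scenario_tree N P i0) :
  value P A f l lN N x0 i0 = optimal_value T F b f l lN x0.
Proof.
apply: le_anti; apply/andP; split.
  apply: le_ereal_inf_tmp => _ [d fd <-].
  have stage_first : stage (first T) = 1%N by apply/stage1.
  rewrite -[X in value _ _ _ _ _ X](prednK hN).
  apply: le_trans (ereal_inf_lbound _) _; first by exists (du d (first T)).
  have child_first : first T \in child (Defs.root T) by rewrite child_root inE.
  have stage_root : (stage (Defs.root T) <= N.-1)%N by rewrite (iffRL (stage0 _) erefl).
  (* With [u^1] as input, the risk term in the value at the root is the one bounded by the dual cost
     of the first node. *)
  have := @markov_risk_le_dual_cost _ _ _ _ _ _ _ _ _ _ _ _ _ _ _ _ _ N.-1 (first T)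
    hP hA hdom hpoly fd.
  rewrite (feas_dynamics fd stage_root child_first) (feas_root fd) mode_first.
  by rewrite stage_first add1n prednK // => /(_ isT erefl) le_cost; apply: leeD2l.
have V0 := @value_ge0 _ _ _ _ _ _ f _ _ N x0 i0 hP hA hl hlN.
have [->|V_fin] := eqVneq (value P A f l lN N x0 i0) +oo%E; first by rewrite leey.
(* The construction needs a budget strictly above the value, hence the arbitrary [eps]. *)
apply/lee_addgt0Pr => eps eps0.
have VE : value P A f l lN N x0 i0 = (fine (value P A f l lN N x0 i0))%:E.
  by rewrite fineK // ge0_fin_numE // ltey.
have [|d fd le_t] := @exists_feasible_budget _ _ _ _ _ _ _ _ F b f l lN x0 i0 T
  (fine (value P A f l lN N x0 i0) + eps) hP hA hpoly hl hlN hN.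
  by rewrite {1}VE lte_fin ltrDl.
rewrite {1}VE -EFinD; apply: le_trans le_t.
by apply: ereal_inf_lbound; exists d.
Qed.
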